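(* If a problem $\mathsf{P}$ has an arithmetical representation, then $\mathsf{P}\leq_W\mathsf{P}^{\mathrm{rfn}}$ but $\mathsf{P}^{\mathrm{rfn}}\not\leq_W^a\mathsf{P}$.
   Context: A (Weihrauch) problem is a partial function $\mathsf{P}$ from $\mathcal{P}(\omega)$ to $\mathcal{P}(\mathcal{P}(\omega))$ with nonempty domain; for $X\in\mathrm{dom}(\mathsf{P})$ (an input) the elements of $\mathsf{P}(X)$ are its outputs. Numbers, functions, tuples and sequences of sets are identified with subsets of $\omega$ via canonical computable bijections. $\mathsf{P}\leq_W\mathsf{Q}$ means there are computable functionals $\Phi,\Psi$ such that for all $X\in\mathrm{dom}(\mathsf{P})$, $\Phi(X)$ is defined and in $\mathrm{dom}(\mathsf{Q})$, and for all $Y\in\mathsf{Q}(\Phi(X))$, $\Psi(X,Y)$ is defined and in $\mathsf{P}(X)$. Arithmetical Weihrauch reducibility $\leq_W^a$ is defined in the same way with $\Phi,\Psi$ arithmetically definable functionals instead of computable ones. $\mathsf{P}$ has an arithmetical representation if there are arithmetical formulas $\theta(X),\eta(X,Y)$ of second-order arithmetic such that (in $(\omega,\mathcal{P}(\omega))$) some $X$ satisfies $\theta$, every $X$ with $\theta(X)$ has some $Y$ with $\eta(X,Y)$, $\mathrm{dom}(\mathsf{P})=\{X:\theta(X)\}$ and $\mathsf{P}(X)=\{Y:\eta(X,Y)\}$. An effective $\omega$-model of $\mathbf{ACA}_0$ is a triple $(\langle M_i\rangle_{i\in\omega},f,g)$ with $M_i\subseteq\omega$, $f:\omega\to\omega$,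 $g:\omega^2\to\omega$ such that $\{M_i:i\in\omega\}$ is closed downward under $\leq_T$, $M_{f(i)}=(M_i)'$ (Turing jump) and $M_{g(i,j)}=M_i\oplus M_j$ for all $i,j$. For a problem $\mathsf{P}$, the $\omega$-model reflection $\mathsf{P}^{\mathrm{rfn}}$ is the problem whose inputs are all sets $X$ and whose outputs on $X$ are the tuples $(\langle M_i\rangle_i,f,g,e)$ such that $(\langle M_i\rangle_i,f,g)$ is an effective $\omega$-model of $\mathbf{ACA}_0$, $M_e=X$, and $\forall i(M_i\in\mathrm{dom}\,\mathsf{P}\to\exists j(M_j\in\mathsf{P}(M_i)))$. *)

(* Defs.v *)
From mathcomp Require Import all_boot.
From mathcomp Require Import boolp classical_sets.
From Stdlib Require Cantor.
Set Implicit Arguments.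
Unset Strict Implicit.
Unset Printing Implicit Defensive.

Local Open Scope classical_set_scope.

Definition pairn (x y : nat) : nat := Cantor.to_nat (x, y).

(** * Oracle computability *)

(** Codes for the partial functions [nat -> nat] that are recursive in an
    oracle.  All of them are unary: further arguments are passed with [pairn]. *)
Inductive code : Type :=
| CZero
| CSucc
| CLeft
| CRight
| COracle
| CPair of code & code
| CComp of code & code
| CRec of code & code
| CMu of code.

Definition char_fun (X : set nat) (n r : nat) : Prop :=
  (X n /\ r = 1) \/ (~ X n /\ r = 0).

(** Graph of the [h] with [h(a, 0) = F(a)] and [h(a, m+1) = G(a, (m, h(a, m)))]. *)
Fixpoint prim_rec (F G : nat -> nat -> Prop) (a m r : nat) : Prop :=
  if m is m'.+1
  then exists s, prim_rec F G a m' s /\ G (pairn a (pairn m' s)) r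
  else F a r.

(** [eval X c n r]: the computation of [c] with oracle [X] on input [n]
    converges with value [r]. *)
Fixpoint eval (X : set nat) (c : code) (n r : nat) : Prop :=
  match c with
  | CZero => r = 0
  | CSucc => r = n.+1
  | CLeft => r = (Cantor.of_nat n).1
  | CRight => r = (Cantor.of_nat n).2
  | COracle => char_fun X n r
  | CPair c1 c2 =>
      exists s t, [/\ eval X c1 n s, eval X c2 n t & r = pairn s t]
  | CComp c1 c2 => exists s, eval X c2 n s /\ eval X c1 s r
  | CRec c1 c2 =>
      prim_rec (eval X c1) (eval X c2) (Cantor.of_nat n).1 (Cantor.of_nat n).2 r
  | CMu c1 =>
      eval X c1 (pairn n r) 0 /\
      forall m, m < r -> exists k, eval X c1 (pairn n m) k.+1
  end.

(** Gödel numbering of codes. *)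
Fixpoint encode (c : code) : nat :=
  match c with
  | CZero => pairn 0 0
  | CSucc => pairn 1 0
  | CLeft => pairn 2 0
  | CRight => pairn 3 0
  | COracle => pairn 4 0
  | CPair c1 c2 => pairn 5 (pairn (encode c1) (encode c2))
  | CComp c1 c2 => pairn 6 (pairn (encode c1) (encode c2))
  | CRec c1 c2 => pairn 7 (pairn (encode c1) (encode c2))
  | CMu c1 => pairn 8 (encode c1)
  end.

(** With oracle [X], [c] computes the characteristic function of [Y]. *)
Definition computes (c : code) (X Y : set nat) : Prop :=
  forall n r, eval X c n r <-> char_fun Y n r.

Definition turing_le (A B : set nat) : Prop := exists c, computes c B A.

(** The diagonal halting set; numbers which are not codes are left out. *)
Definition jump (X : set nat) : set nat :=
  [set n | exists c, n = encode c /\ exists r, eval X c n r].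

Definition join (A B : set nat) : set nat :=
  [set n.*2 | n in A] `|` [set n.*2.+1 | n in B].

(** * Arithmetical formulas *)

Inductive term (n : nat) : Type :=
| TVar of 'I_n
| TZero
| TOne
| TAdd of term n & term n
| TMul of term n & term n.

(** Formulas of second-order arithmetic without set quantifiers, whose free
    variables are among [k] set variables and [n] number variables.  There are
    no set parameters.  A number quantifier binds the variable [ord0]. *)
Inductive formula (k : nat) : nat -> Type :=
| FEq n of term n & term n : formula k n
| FLt n of term n & term n : formula k n
| FMem n of term n & 'I_k : formula k n
| FNot n of formula k n : formula k n
| FAnd n of formula k n & formula k n : formula k n
| FOr n of formula k n & formula k n : formula k n
| FImp n of formula k n & formula k n : formula k n
| FAll n of formula k n.+1 : formula k n
| FEx n of formula k n.+1 : formula k n.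

Fixpoint teval n (v : n.-tuple nat) (t : term n) : nat :=
  match t with
  | TVar i => tnth v i
  | TZero => 0
  | TOne => 1
  | TAdd t1 t2 => teval v t1 + teval v t2
  | TMul t1 t2 => teval v t1 * teval v t2
  end.

Fixpoint holds k (S : k.-tuple (set nat)) n (phi : formula k n) :
    n.-tuple nat -> Prop :=
  match phi in formula _ n return n.-tuple nat -> Prop with
  | FEq _ t u => fun v => teval v t = teval v u
  | FLt _ t u => fun v => teval v t < teval v u
  | FMem _ t i => fun v => tnth S i (teval v t)
  | FNot _ p => fun v => ~ holds S p v
  | FAnd _ p q => fun v => holds S p v /\ holds S q v
  | FOr _ p q => fun v => holds S p v \/ holds S q v
  | FImp _ p q => fun v => holds S p v -> holds S q v
  | FAll _ p => fun v => forall m : nat, holds S p [tuple of m :: v]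
  | FEx _ p => fun v => exists m : nat, holds S p [tuple of m :: v]
  end.

(** * Problems and reducibilities *)

(** A partial function from P(ω) to P(P(ω)); the values of [outputs] outside
    [inputs] are irrelevant. *)
Record problem : Type := Problem {
  inputs : set (set nat);
  outputs : set nat -> set (set nat);
  inputs_nonempty : inputs !=set0
}.

(** Partial functionals from P(ω) to P(ω), given by their graphs; [F X] is
    defined when [F X Y] holds for some [Y]. *)
Definition functional := set nat -> set nat -> Prop.

Definition computable_functional (F : functional) : Prop :=
  exists c, forall X Y, F X Y <-> computes c X Y.

(** The values of an arithmetically definable functional are uniformly
    arithmetical in its argument.  This is stronger than having an arithmetical
    graph: the graph of [X |-> X^(ω)] is arithmetical. *)
Definition arithmetical_functional (F : functional) : Prop :=
  exists phi : formula 1 1, forall X Y,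
    F X Y <-> Y = [set n | holds [tuple X] phi [tuple n]].

(** The two-argument functional [Psi] takes [(X, Y)] coded as [join X Y]. *)
Definition reducible (C : functional -> Prop) (P Q : problem) : Prop :=
  exists Phi Psi : functional, [/\ C Phi, C Psi &
    forall X, inputs P X ->
      exists2 Z, Phi X Z & inputs Q Z /\
        forall Y, outputs Q Z Y ->
          exists2 W, Psi (join X Y) W & outputs P X W].

Definition weihrauch_le := reducible computable_functional.
Definition arith_weihrauch_le := reducible arithmetical_functional.

Definition has_arithmetical_representation (P : problem) : Prop :=
  exists (theta : formula 1 0) (eta : formula 2 0),
    [/\ exists X, holds [tuple X] theta [tuple],
        forall X, holds [tuple X] theta [tuple] ->
          exists Y, holds [tuple X; Y] eta [tuple],
        forall X, inputs P X <-> holds [tuple X] theta [tuple] &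
        forall X, inputs P X ->
          forall Y, outputs P X Y <-> holds [tuple X; Y] eta [tuple]].

(** * Reflection by effective ω-models *)

Record effective_model (M : nat -> set nat) (f : nat -> nat)
    (g : nat -> nat -> nat) : Prop := EffectiveModel {
  model_turing_closed :
    forall i A, turing_le A (M i) -> exists j, M j = A;
  model_jump : forall i, M (f i) = jump (M i);
  model_join : forall i j, M (g i j) = join (M i) (M j)
}.

Definition seq_code (M : nat -> set nat) : set nat :=
  [set x | exists i n, x = pairn i n /\ M i n].

Definition fun_code (f : nat -> nat) : set nat :=
  [set x | exists i, x = pairn i (f i)].

Definition fun2_code (g : nat -> nat -> nat) : set nat :=
  [set x | exists i j, x = pairn (pairn i j) (g i j)].

Definition tuple_code (M : nat -> set nat) (f : nat -> nat)
    (g : nat -> nat -> nat) (e : nat) : set nat :=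
  join (seq_code M) (join (fun_code f) (join (fun2_code g) [set e])).

Definition rfn_outputs (P : problem) (X : set nat) : set (set nat) :=
  [set Z | exists M f g e,
    [/\ Z = tuple_code M f g e, effective_model M f g, M e = X &
        forall i, inputs P (M i) -> exists j, outputs P (M i) (M j)]].

Lemma setT_sets_nonempty : [set: set nat] !=set0.
Proof. by exists set0. Qed.

Definition rfn (P : problem) : problem :=
  Problem (rfn_outputs P) setT_sets_nonempty.

(* Main.v *)
Require Import Defs.
From mathcomp Require Import all_boot.
From mathcomp Require Import boolp classical_sets.
From Stdlib Require Cantor.
Set Implicit Arguments.
Unset Strict Implicit.
Unset Printing Implicit Defensive.

Local Open Scope classical_set_scope.

Arguments pairn : simpl never.

(** The theorem rests on one principle: arithmetical truths about the members of
    an effective model are decidable, uniformly, from a code of the model.  A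
    formula about [A] is decided by the [d]-th jump of [A] for a [d] depending
    only on the formula ([arith_holds]); if [A] is the [i]-th member of a model
    whose jumps are tracked by [f], this jump is again a member, with index
    [f (... (f i))], so the code of the model knows it ([udec_member_arith]).

    Reduction of P to its reflection: an input [X] is passed on unchanged.  The
    model received contains [X], hence a solution of [X] among its members.
    Being a solution is an arithmetical property of the join of [X] with the
    candidate, and this join is again a member whose index is computed by [g];
    so a solution can be found by searching through the members.

    No converse arithmetical reduction: suppose one exists and feed it the empty
    set.  It asks P for the fixed arithmetical input [Z0]; call [A] good if it is
    a join of [Z0] with a solution of [Z0].  Every good [A] arithmetically yields
    an effective model, which contains [Z0], reflects P, and therefore contains
    a good set again.  Membership in these models is a relation between good sets
    that is transitive and has no minimal element.  This is refuted as in the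
    proof of Gödel's second incompleteness theorem, by the liar sentence of
    well-foundedness: a property [delta] such that [delta A] holds iff some good
    member of the model of [A] fails [delta] ([no_liar_descent]).  The property
    is obtained with no recursion theorem, from a diagonal argument on the
    halting set.  The model of [A] is computable from a jump [J A] of [A] of fixed order; so
    there is a program [p] which with oracle [J A] halts on [n] iff some good
    member [B] of the model has [n] outside the halting set of [J B].  As the
    halting set is the diagonal one, [delta A] can be taken to say that the code
    of [p] lies in the halting set of [J A]. *)

(** * Pairing and codes *)

Definition unpairl (x : nat) : nat := (Cantor.of_nat x).1.
Definition unpairr (x : nat) : nat := (Cantor.of_nat x).2.

Lemma pairnKl a b : unpairl (pairn a b) = a.
Proof. by rewrite /unpairl /pairn Cantor.cancel_of_to. Qed.

Lemma pairnKr a b : unpairr (pairn a b) = b.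
Proof. by rewrite /unpairr /pairn Cantor.cancel_of_to. Qed.

Definition pairnK := (pairnKl, pairnKr).

Lemma pairn_inj a b a' b' : pairn a b = pairn a' b' -> a = a' /\ b = b'.
Proof. by move=> e; rewrite -(pairnKl a b) -{2}(pairnKr a b) e !pairnK. Qed.

Lemma encode_inj : injective encode.
Proof.
elim=> [|||||c1 IH1 c2 IH2|c1 IH1 c2 IH2|c1 IH1 c2 IH2|c1 IH1]
  [|||||d1 d2|d1 d2|d1 d2|d1] //= /pairn_inj[] // _.
- by move=> /pairn_inj[/IH1 -> /IH2 ->].
- by move=> /pairn_inj[/IH1 -> /IH2 ->].
- by move=> /pairn_inj[/IH1 -> /IH2 ->].
- by move=> /IH1 ->.
Qed.

Lemma jump_encode (X : set nat) c :
  jump X (encode c) <-> exists r, eval X c (encode c) r.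
Proof.
split; first by move=> [c' [/encode_inj <-]].
by move=> h; exists c.
Qed.

(** * Uniform computability *)

(** The oracle and the function depend on a parameter [t] ranging over any type,
    and one program serves all parameters.  The parameter carries what is not
    computable, such as a model together with the proofs of its properties.  The
    equivalence with [r = h t n] also makes the evaluation single-valued. *)
Definition ucomp T (O : T -> set nat) (h : T -> nat -> nat) : Prop :=
  exists c, forall t n r, eval (O t) c n r <-> r = h t n.

Definition udec T (O R : T -> set nat) : Prop :=
  ucomp O (fun t n => nat_of_bool `[<R t n>]).

Lemma char_funE (X : set nat) n r : char_fun X n r <-> r = `[<X n>].
Proof.
rewrite /char_fun; case: asboolP => h /=; split.
- by case=> [[]|[]].
- by left.
- by case=> [[]|[]].
- by right.
Qed.

Lemma udecP T (O R : T -> set nat) :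
  udec O R <-> exists c, forall t, computes c (O t) (R t).
Proof.
split=> -[c hc]; exists c => t.
  by move=> n r; rewrite hc char_funE.
by move=> n r; rewrite hc char_funE.
Qed.

Lemma ucomp_ext T (O : T -> set nat) (h h' : T -> nat -> nat) :
  (forall t n, h t n = h' t n) -> ucomp O h -> ucomp O h'.
Proof. by move=> e [c hc]; exists c => t n r; rewrite hc e. Qed.

Lemma udec_ext T (O R R' : T -> set nat) :
  (forall t n, R t n <-> R' t n) -> udec O R -> udec O R'.
Proof.
by move=> e; apply: ucomp_ext => t n; congr nat_of_bool; apply: asbool_equiv_eq.
Qed.

Section Closure.
Context {T : Type} (O : T -> set nat).
Implicit Types (h a b : T -> nat -> nat) (R : T -> set nat).

Lemma ucomp_comp h a :
  ucomp O h -> ucomp O a -> ucomp O (fun t n => h t (a t n)).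
Proof.
move=> [c hc] [d hd]; exists (CComp c d) => t n r /=; split.
  by move=> [s []]; rewrite hd hc => ->.
by move=> ->; exists (a t n); rewrite hd hc.
Qed.

Lemma ucomp_pair a b :
  ucomp O a -> ucomp O b -> ucomp O (fun t n => pairn (a t n) (b t n)).
Proof.
move=> [c hc] [d hd]; exists (CPair c d) => t n r /=; split.
  by move=> [_ [_ [/hc -> /hd ->]]].
by move=> ->; exists (a t n), (b t n); split=> //; [exact/hc | exact/hd].
Qed.

Lemma ucomp_comp2 h a b : ucomp O h -> ucomp O a -> ucomp O b ->
  ucomp O (fun t n => h t (pairn (a t n) (b t n))).
Proof. by move=> hh ha hb; apply: ucomp_comp hh _; apply: ucomp_pair. Qed.

Lemma ucompS a : ucomp O a -> ucomp O (fun t n => (a t n).+1).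
Proof. by apply: (@ucomp_comp (fun=> S)); exists CSucc. Qed.

Lemma ucomp_const k : ucomp O (fun _ _ => k).
Proof. by elim: k => [|k IH]; [exists CZero | apply: ucompS]. Qed.

Lemma ucompl a : ucomp O a -> ucomp O (fun t n => unpairl (a t n)).
Proof. by apply: (@ucomp_comp (fun=> unpairl)); exists CLeft. Qed.

Lemma ucompr a : ucomp O a -> ucomp O (fun t n => unpairr (a t n)).
Proof. by apply: (@ucomp_comp (fun=> unpairr)); exists CRight. Qed.

Lemma ucomp_id : ucomp O (fun _ n => n).
Proof.
exists (CPair CLeft CRight) => t n r /=; split.
  by move=> [_ [_ [-> ->]]] ->; rewrite /pairn -surjective_pairing Cantor.cancel_to_of.
move=> ->; exists (unpairl n), (unpairr n); split=> //.
by rewrite /pairn -surjective_pairing Cantor.cancel_to_of.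
Qed.

Lemma udec_oracle : udec O O.
Proof. by apply/udecP; exists COracle. Qed.

Lemma ucomp_rec (b s k : T -> nat -> nat) :
  ucomp O b -> ucomp O s -> ucomp O k ->
  ucomp O (fun t n => iteri (k t n) (fun m acc => s t (pairn n (pairn m acc)))
                        (b t n)).
Proof.
move=> [c hc] [d hd] hk.
have rec : ucomp O (fun t x => iteri (unpairr x)
    (fun m acc => s t (pairn (unpairl x) (pairn m acc))) (b t (unpairl x))).
  exists (CRec c d) => t x r /=; rewrite -/(unpairl x) -/(unpairr x).
  elim: (unpairr x) r => [|m IH] r /=; first exact: hc.
  split; first by move=> [y [/IH -> /hd]].
  by move=> ->; eexists; split; [exact/IH | exact/hd].
apply: ucomp_ext (ucomp_comp2 rec ucomp_id hk) => t n.
by rewrite !pairnK.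
Qed.

Lemma ucomp_if0 (k a b : T -> nat -> nat) :
  ucomp O k -> ucomp O a -> ucomp O b ->
  ucomp O (fun t n => if k t n is 0 then a t n else b t n).
Proof.
move=> hk ha hb.
have := ucomp_rec ha (ucomp_comp hb (ucompl ucomp_id)) hk.
apply: ucomp_ext => t n; case: (k t n) => //= m.
by rewrite pairnKl.
Qed.

Lemma ucompD a b : ucomp O a -> ucomp O b -> ucomp O (fun t n => a t n + b t n).
Proof.
move=> ha hb.
have := ucomp_rec ha (ucompS (ucompr (ucompr ucomp_id))) hb.
apply: ucomp_ext => t n; elim: (b t n) => [|m IH] /=; first by rewrite addn0.
by rewrite IH !pairnKr addnS.
Qed.

Lemma ucompM a b : ucomp O a -> ucomp O b -> ucomp O (fun t n => a t n * b t n).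
Proof.
move=> ha hb.
have := ucomp_rec (ucomp_const 0)
  (ucompD (ucomp_comp ha (ucompl ucomp_id)) (ucompr (ucompr ucomp_id))) hb.
apply: ucomp_ext => t n; elim: (b t n) => [|m IH] /=; first by rewrite muln0.
by rewrite IH !pairnK mulnS.
Qed.

Lemma ucomp_pred a : ucomp O a -> ucomp O (fun t n => (a t n).-1).
Proof.
move=> ha.
have := ucomp_rec (ucomp_const 0) (ucompl (ucompr ucomp_id)) ha.
by apply: ucomp_ext => t n; case: (a t n) => //= m; rewrite !pairnK.
Qed.

Lemma ucompB a b : ucomp O a -> ucomp O b -> ucomp O (fun t n => a t n - b t n).
Proof.
move=> ha hb.
have := ucomp_rec ha (ucomp_pred (ucompr (ucompr ucomp_id))) hb.
apply: ucomp_ext => t n; elim: (b t n) => [|m IH] /=; first by rewrite subn0.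
by rewrite IH !pairnKr subnS.
Qed.

Lemma udec_comp R a : udec O R -> ucomp O a -> udec O (fun t n => R t (a t n)).
Proof. exact: ucomp_comp. Qed.

Lemma udec_comp2 R a b : udec O R -> ucomp O a -> ucomp O b ->
  udec O (fun t n => R t (pairn (a t n) (b t n))).
Proof. exact: ucomp_comp2. Qed.

Lemma udec_eq0 a : ucomp O a -> udec O (fun t n => a t n = 0).
Proof.
move=> ha; apply: ucomp_ext (ucomp_if0 ha (ucomp_const 1) (ucomp_const 0)) => t n.
by case: asboolP; case: (a t n).
Qed.

Lemma udec_not R : udec O R -> udec O (fun t n => ~ R t n).
Proof.
move=> hR; apply: udec_ext (udec_eq0 hR) => t n.
by case: asboolP.
Qed.

Lemma udec_and R R' : udec O R -> udec O R' -> udec O (fun t n => R t n /\ R' t n).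
Proof.
move=> hR hR'; apply: ucomp_ext (ucompM hR hR') => t n.
by rewrite mulnb -asbool_and.
Qed.

Lemma udec_or R R' : udec O R -> udec O R' -> udec O (fun t n => R t n \/ R' t n).
Proof.
move=> hR hR'; apply: udec_ext (udec_not (udec_and (udec_not hR) (udec_not hR'))).
by move=> t n; rewrite -not_orP notK.
Qed.

Lemma udec_imp R R' : udec O R -> udec O R' -> udec O (fun t n => R t n -> R' t n).
Proof.
move=> hR hR'; apply: udec_ext (udec_or (udec_not hR) hR').
by move=> t n; rewrite implyE.
Qed.

Lemma udec_le a b : ucomp O a -> ucomp O b -> udec O (fun t n => a t n <= b t n).
Proof.
move=> ha hb; apply: udec_ext (udec_eq0 (ucompB ha hb)) => t n.
by split=> /eqP.
Qed.

Lemma udec_eq a b : ucomp O a -> ucomp O b -> udec O (fun t n => a t n = b t n).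
Proof.
move=> ha hb; apply: udec_ext (udec_and (udec_le ha hb) (udec_le hb ha)) => t n.
by split=> [[h h']|->//]; apply/anti_leq/andP.
Qed.

Lemma halting_search R : udec O R ->
  exists c, forall t n r, eval (O t) c n r <->
     R t (pairn n r) /\ forall m, m < r -> ~ R t (pairn n m).
Proof.
move=> /udec_not[c hc]; exists (CMu c) => t n r /=; split=> -[h h']; split.
- by move: h; rewrite hc asbool_neg; case: asboolP.
- by move=> m /h'[k]; rewrite hc asbool_neg; case: asboolP.
- by rewrite hc asbool_neg; case: asboolP.
- by move=> m /h' h''; exists 0; rewrite hc asbool_neg; case: asboolP.
Qed.

(** The program is unbounded search: it can only return the least witness. *)
Lemma halting_ex R : udec O R ->
  exists c, forall t n, (exists r, eval (O t) c n r) <-> exists m, R t (pairn n m).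
Proof.
move=> /halting_search[c hc]; exists c => t n; split=> -[m].
  by rewrite hc => -[]; exists m.
move=> hm.
have ex : exists m, `[<R t (pairn n m)>] by exists m; apply/asboolP.
exists (ex_minn ex); rewrite hc; case: ex_minnP => r /asboolP hr min; split=> //.
by move=> k kr /asboolP/min; rewrite leqNgt kr.
Qed.

Lemma ucomp_search R : udec O R -> (forall t n, exists m, R t (pairn n m)) ->
  exists2 h, ucomp O h & forall t n, R t (pairn n (h t n)).
Proof.
move=> /halting_search[c hc] ex.
have ex' t n : exists m, `[<R t (pairn n m)>].
  by have [m hm] := ex t n; exists m; apply/asboolP.
exists (fun t n => ex_minn (ex' t n)); last first.
  by move=> t n; case: ex_minnP => r /asboolP.
exists c => t n r; rewrite hc; case: ex_minnP => k /asboolP hk min; split.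
  move=> [hr min']; apply/anti_leq/andP; split; last exact/min/asboolP.
  by rewrite leqNgt; apply/negP => /min'.
move=> ->; split=> // m mk /asboolP/min; rewrite leqNgt mk //.
Qed.

End Closure.

Lemma eval_comp_total X c d n k r : (forall s, eval X d n s <-> s = k) ->
  eval X (CComp c d) n r <-> eval X c k r.
Proof.
move=> hd; split; first by move=> [s [/hd ->]].
by move=> h; exists k; rewrite hd.
Qed.

(** Relativization: the oracle [O' (tau t i)] is itself decided by [O t],
    uniformly in the run-time index [i].  In the translated program, [i] has to
    be carried along as the left component of every argument, so that it is
    available whenever a query is answered. *)
Lemma eval_subst T T' (O : T -> set nat) (O' : T' -> set nat)
    (tau : T -> nat -> T') (c : code) :
  udec O (fun t x => O' (tau t (unpairl x)) (unpairr x)) ->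
  exists c', forall t i n r,
    eval (O t) c' (pairn i n) r <-> eval (O' (tau t i)) c n r.
Proof.
move=> [q hq].
have idc : ucomp O (fun _ n => n) by exact: ucomp_id.
elim: c => [|||||c1 [d1 h1] c2 [d2 h2]|c1 [d1 h1] c2 [d2 h2]
           |c1 [d1 h1] c2 [d2 h2]|c1 [d1 h1]].
- by exists CZero.
- have [c hc] := ucompS (ucompr idc).
  by exists c => t i n r; rewrite hc pairnKr.
- have [c hc] := ucompl (ucompr idc).
  by exists c => t i n r; rewrite hc pairnKr.
- have [c hc] := ucompr (ucompr idc).
  by exists c => t i n r; rewrite hc pairnKr.
- by exists q => t i n r; rewrite hq [_ <-> eval _ _ _ _]/= char_funE !pairnK.
- exists (CPair d1 d2) => t i n r /=.
  by split=> -[s [s' [/h1 ? /h2 ? ->]]]; exists s, s'.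
- exists (CComp d1 (CPair CLeft d2)) => t i n r /=; split.
    move=> [_ [[_ [s [-> /h2 ? ->]]]]]; rewrite -/(unpairl _) pairnKl => /h1 ?.
    by exists s.
  move=> [s [/h2 ? /h1 ?]]; exists (pairn i s); split=> //.
  by exists i, s; rewrite -/(unpairl _) pairnKl.
(* In the recursion, the parameter [n1] becomes [(i, n1)], and the
     argument [((i, n1), x)] of the step is rearranged into [(i, (n1, x))]. *)
- have [pre hpre] := ucomp_pair (ucomp_pair (ucompl idc) (ucompl (ucompr idc)))
                                (ucompr (ucompr idc)).
  have [arr harr] := ucomp_pair (ucompl (ucompl idc))
                       (ucomp_pair (ucompr (ucompl idc)) (ucompr idc)).
  exists (CComp (CRec d1 (CComp d2 arr)) pre) => t i n r.
  rewrite (eval_comp_total _ _ (hpre t _)) !pairnK.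
  have step a x s : eval (O t) (CComp d2 arr) (pairn (pairn i a) x) s <->
                    eval (O' (tau t i)) c2 (pairn a x) s.
    by rewrite (eval_comp_total _ _ (harr t _)) !pairnK; apply: h2.
  rewrite [X in X <-> _]/= [X in _ <-> X]/= -!/(unpairl _) -!/(unpairr _) !pairnK.
  elim: (unpairr n) r => [|m IH] r; first exact: h1.
  by split=> -[s [/IH hs /step ?]]; exists s.
- have [arr harr] := ucomp_pair (ucompl (ucompl idc))
                       (ucomp_pair (ucompr (ucompl idc)) (ucompr idc)).
  exists (CMu (CComp d1 arr)) => t i n r.
  have step m s : eval (O t) (CComp d1 arr) (pairn (pairn i n) m) s <->
                  eval (O' (tau t i)) c1 (pairn n m) s.
    by rewrite (eval_comp_total _ _ (harr t _)) !pairnK; apply: h1.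
  split=> -[/step h h']; split=> // m /h'[k /step ?]; by exists k.
Qed.

Lemma ucomp_subst T T' (O : T -> set nat) (O' : T' -> set nat)
    (h : T' -> nat -> nat) (tau : T -> nat -> T') :
  ucomp O' h -> udec O (fun t x => O' (tau t (unpairl x)) (unpairr x)) ->
  ucomp O (fun t x => h (tau t (unpairl x)) (unpairr x)).
Proof.
move=> [c hc] hO'; have [c' hc'] := eval_subst (O' := O') (tau := tau) c hO'.
have idc : ucomp O (fun _ n => n) by exact: ucomp_id.
have [pre hpre] := ucomp_pair (ucompl idc) (ucompr idc).
exists (CComp c' pre) => t x r.
by rewrite (eval_comp_total _ _ (hpre t x)) hc'.
Qed.

Lemma ucomp_trans T T' (O : T -> set nat) (O' : T' -> set nat)
    (h : T' -> nat -> nat) (tau : T -> T') :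
  ucomp O' h -> udec O (fun t => O' (tau t)) -> ucomp O (fun t => h (tau t)).
Proof.
move=> hh hO; have idc : ucomp O (fun _ n => n) by exact: ucomp_id.
have hO' : udec O (fun t x => O' (tau t) (unpairr x)).
  exact: udec_comp hO (ucompr idc).
have := ucomp_comp2 (ucomp_subst (O' := O') (tau := fun t _ => tau t) hh hO') idc idc.
by apply: ucomp_ext => t n; rewrite pairnKr.
Qed.

Lemma udec_trans T T' (O : T -> set nat) (O' R : T' -> set nat) (tau : T -> T') :
  udec O' R -> udec O (fun t => O' (tau t)) -> udec O (fun t => R (tau t)).
Proof. exact: ucomp_trans. Qed.

Lemma udec_subst T T' (O : T -> set nat) (O' R : T' -> set nat)
    (tau : T -> nat -> T') :
  udec O' R -> udec O (fun t x => O' (tau t (unpairl x)) (unpairr x)) ->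
  udec O (fun t x => R (tau t (unpairl x)) (unpairr x)).
Proof. exact: ucomp_subst. Qed.

(** * Jumps and arithmetical formulas *)

(** Precomposing a program with [const_code k] makes its behaviour on every
    input, in particular on its own code, that of the program on [k]. *)
Definition const_code (k : nat) : code := iter k (CComp CSucc) CZero.

Lemma eval_const_code X k n r : eval X (const_code k) n r <-> r = k.
Proof.
elim: k r => [|k IH] r //=; split; first by move=> [s [/IH -> ->]].
by move=> ->; exists k; rewrite IH.
Qed.

(** The program that searches for a witness for a hardcoded [n] ignores its
    input, so its halting on its own code, which is all that the diagonal
    halting set records, amounts to the existence of a witness.  The code of
    this program is computed from [n] by primitive recursion. *)
Lemma udec_jump_ex T (O R : T -> set nat) : udec O R ->
  udec (fun t => jump (O t)) (fun t n => exists m, R t (pairn n m)).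
Proof.
move=> /halting_ex[c hc]; set J := fun t => jump (O t).
have idc : ucomp J (fun _ n => n) by exact: ucomp_id.
have const_enc : ucomp J (fun _ n => encode (const_code n)).
  have := ucomp_rec (ucomp_const J (encode CZero))
    (ucomp_pair (ucomp_const J 6)
      (ucomp_pair (ucomp_const J (encode CSucc)) (ucompr (ucompr idc)))) idc.
  apply: ucomp_ext => _ n; elim: {1 3}n => [|k IH] //. 
  by rewrite [LHS]/= !pairnKr IH.
have enc : ucomp J (fun _ n => encode (CComp c (const_code n))).
  exact: (ucomp_pair (ucomp_const J 6)
           (ucomp_pair (ucomp_const J (encode c)) const_enc)).
apply: udec_ext (udec_comp (udec_oracle J) enc) => t n.
rewrite /J jump_encode -hc.
have ev r : eval (O t) (CComp c (const_code n))
    (encode (CComp c (const_code n))) r <-> eval (O t) c n r.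
  exact/eval_comp_total/eval_const_code.
by split=> -[r hr]; exists r; apply/ev.
Qed.

Definition jumps d T (O : T -> set nat) (t : T) : set nat := iter d jump (O t).

Lemma udec_jumpsS T (O R : T -> set nat) d :
  udec (jumps d O) R -> udec (jumps d.+1 O) R.
Proof.
move=> hR; have idc : ucomp (jumps d O) (fun _ n => n) by exact: ucomp_id.
apply: udec_ext (udec_jump_ex (udec_comp hR (ucompl idc))) => t n.
split; first by move=> [m]; rewrite pairnKl.
by move=> h; exists 0; rewrite pairnKl.
Qed.

Lemma udec_jumps_le T (O R : T -> set nat) d e :
  d <= e -> udec (jumps d O) R -> udec (jumps e O) R.
Proof.
move=> /subnK <-; elim: (e - d) => [|k IH] // h.
exact/udec_jumpsS/IH.
Qed.

Definition arith T (O R : T -> set nat) : Prop := exists d, udec (jumps d O) R.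

Section Arith.
Context {T : Type} (O : T -> set nat).
Implicit Types R : T -> set nat.

Lemma arith_udec R : udec O R -> arith O R.
Proof. by exists 0. Qed.

Lemma arith_common R R' : arith O R -> arith O R' ->
  exists d, udec (jumps d O) R /\ udec (jumps d O) R'.
Proof.
move=> [d hd] [e he]; exists (maxn d e); split.
  exact: udec_jumps_le (leq_maxl _ _) hd.
exact: udec_jumps_le (leq_maxr _ _) he.
Qed.

Lemma arith_not R : arith O R -> arith O (fun t n => ~ R t n).
Proof. by move=> [d hd]; exists d; apply: udec_not. Qed.

Lemma arith_and R R' : arith O R -> arith O R' ->
  arith O (fun t n => R t n /\ R' t n).
Proof. by move=> h /(arith_common h)[d []]; exists d; apply: udec_and. Qed.

Lemma arith_or R R' : arith O R -> arith O R' ->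
  arith O (fun t n => R t n \/ R' t n).
Proof. by move=> h /(arith_common h)[d []]; exists d; apply: udec_or. Qed.

Lemma arith_imp R R' : arith O R -> arith O R' ->
  arith O (fun t n => R t n -> R' t n).
Proof. by move=> h /(arith_common h)[d []]; exists d; apply: udec_imp. Qed.

Lemma arith_ex R : arith O R -> arith O (fun t n => exists m, R t (pairn m n)).
Proof.
move=> [d hd]; exists d.+1.
have idc : ucomp (jumps d O) (fun _ n => n) by exact: ucomp_id.
have := udec_jump_ex (udec_comp2 hd (ucompr idc) (ucompl idc)).
by apply: udec_ext => t n; split=> -[m hm]; exists m; move: hm; rewrite !pairnK.
Qed.

Lemma arith_all R : arith O R -> arith O (fun t n => forall m, R t (pairn m n)).
Proof.
move=> /arith_not/arith_ex/arith_not[d hd]; exists d.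
by apply: udec_ext hd => t n; rewrite -forallNP; split=> h m; have := h m; rewrite notK.
Qed.

(** Free variables are packed in a number with the innermost one outermost in
    the pairing, so that a quantifier only pairs a value to the left. *)
Fixpoint untuple n (x : nat) : n.-tuple nat :=
  if n is n'.+1 then [tuple of unpairl x :: untuple n' (unpairr x)]
  else [tuple].

Lemma ucomp_teval n (u : term n) : ucomp O (fun _ x => teval (untuple n x) u).
Proof.
elim: u => [i|||u IHu v IHv|u IHu v IHv] /=.
- have idc : ucomp O (fun _ n => n) by exact: ucomp_id.
  elim: n i => [[]//|n IH] i /=.
  case: (unliftP ord0 i) => [j|] ->; last first.
    by apply: ucomp_ext (ucompl idc) => t x; rewrite tnth0.
  apply: ucomp_ext (ucomp_comp (IH j) (ucompr idc)) => t x.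
  by rewrite tnthS.
- exact: ucomp_const.
- exact: ucomp_const.
- exact: ucompD.
- exact: ucompM.
Qed.

(** A quantifier costs one jump, and a connective none beyond the larger of the
    orders needed for its arguments; so the order of the jump and the program
    that uses it depend on the formula only, not on the sets. *)
Lemma arith_holds k (S : T -> k.-tuple (set nat)) n (phi : formula k n) :
  (forall i, udec O (fun t => tnth (S t) i)) ->
  arith O (fun t x => holds (S t) phi (untuple n x)).
Proof.
move=> hS; elim: phi => {n} [n u v|n u v|n u i|n p IH|n p IHp q IHq|n p IHp q IHq
                        |n p IHp q IHq|n p IH|n p IH] /=.
- by apply: arith_udec; apply: udec_eq; apply: ucomp_teval.
- by apply: arith_udec; apply: udec_le; [apply: ucompS|]; apply: ucomp_teval.
- apply: arith_udec.
  exact: (@udec_comp _ _ (fun t => tnth (S t) i) _ (hS i) (ucomp_teval u)).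
- exact: arith_not.
- exact: arith_and.
- exact: arith_or.
- exact: arith_imp.
- have [d hd] := arith_all IH; exists d; apply: udec_ext hd => t x.
  by split=> h m; have := h m; rewrite /= !pairnK.
- have [d hd] := arith_ex IH; exists d; apply: udec_ext hd => t x.
  by split=> -[m hm]; exists m; move: hm; rewrite /= !pairnK.
Qed.

End Arith.

(** * Joins *)

Definition evens (A : set nat) : set nat := [set n | A n.*2].
Definition odds (A : set nat) : set nat := [set n | A n.*2.+1].

Lemma evens_join A B : evens (join A B) = A.
Proof.
apply/seteqP; split=> n; last by move=> h; left; exists n.
move=> [[m h /double_inj <-] //|[m h e]].
by have := congr1 odd e; rewrite /= !odd_double.
Qed.

Lemma odds_join A B : odds (join A B) = B.
Proof.
apply/seteqP; split=> n; last by move=> h; right; exists n.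
move=> [[m h e]|[m h [/double_inj <-]] //].
by have := congr1 odd e; rewrite /= !odd_double.
Qed.

Section Joins.
Context {T : Type} (O : T -> set nat).
Implicit Types A B : T -> set nat.

Lemma ucomp_double a : ucomp O a -> ucomp O (fun t n => (a t n).*2).
Proof. by move=> ha; apply: ucomp_ext (ucompD ha ha) => t n; rewrite addnn. Qed.

Lemma udec_evens A : udec O A -> udec O (fun t => evens (A t)).
Proof. by move=> hA; apply: udec_comp hA (ucomp_double (ucomp_id O)). Qed.

Lemma udec_odds A : udec O A -> udec O (fun t => odds (A t)).
Proof. by move=> hA; apply: udec_comp hA (ucompS (ucomp_double (ucomp_id O))). Qed.

(** The search finds the half of [n], rounded down. *)
Lemma udec_join A B :
  udec O A -> udec O B -> udec O (fun t => join (A t) (B t)).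
Proof.
move=> hA hB; have idc := ucomp_id O.
have [h hh halfP] : exists2 h, ucomp O h &
    forall t n, n = (h t n).*2 \/ n = (h t n).*2.+1.
  have dec : udec O (fun _ x =>
      unpairl x = (unpairr x).*2 \/ unpairl x = (unpairr x).*2.+1).
    exact: (udec_or (udec_eq (ucompl idc) (ucomp_double (ucompr idc)))
             (udec_eq (ucompl idc) (ucompS (ucomp_double (ucompr idc))))).
  have [|h hh hP] := ucomp_search dec.
    move=> _ n; exists n./2; rewrite !pairnK.
    by have := odd_double_half n; case: (odd n) => e; [right|left]; rewrite -[LHS]e.
  by exists h => // t n; have := hP t n; rewrite !pairnK.
have hE : udec O (fun t n => n = (h t n).*2).
  exact: udec_eq idc (ucomp_double hh).
have hOd : udec O (fun t n => n = (h t n).*2.+1).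
  exact: udec_eq idc (ucompS (ucomp_double hh)).
have := udec_or (udec_and hE (udec_comp hA hh)) (udec_and hOd (udec_comp hB hh)).
apply: udec_ext => t n; split.
  by move=> [[e ?]|[e ?]]; [left|right]; exists (h t n).
move=> [[m hm e]|[m hm e]]; [left|right].
- case: (halfP t n) => e'; move: (e); rewrite [in X in X -> _]e'.
    by move=> /double_inj em; split=> //; rewrite -em.
  by move=> /(congr1 odd); rewrite /= !odd_double.
- case: (halfP t n) => e'; move: (e); rewrite [in X in X -> _]e'.
    by move=> /(congr1 odd); rewrite /= !odd_double.
  by move=> [/double_inj em]; split=> //; rewrite -em.
Qed.

End Joins.

(** * Effective models *)

Record model_data := ModelData {
  member : nat -> set nat;
  jump_of : nat -> nat;
  join_of : nat -> nat -> nat;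
  base : nat
}.

Definition model_code (D : model_data) : set nat :=
  tuple_code (member D) (jump_of D) (join_of D) (base D).

Definition effective (D : model_data) : Prop :=
  effective_model (member D) (jump_of D) (join_of D).

Lemma member_jumps D : effective D -> forall d i,
  member D (iter d (jump_of D) i) = iter d jump (member D i).
Proof. by move=> hD; elim=> [|d IH] i //=; rewrite (model_jump hD) IH. Qed.

(** The jump of the member that computes its image under [R] is itself a member,
    and members are closed under Turing reducibility. *)
Lemma member_arith_reduct D (R : set nat -> set nat) : effective D ->
  arith id R -> forall i, exists j, member D j = R (member D i).
Proof.
move=> hD [d /udecP[c hc]] i.
apply: (model_turing_closed hD (i := iter d (jump_of D) i)).
by exists c; rewrite member_jumps //; apply: hc.
Qed.

Section Models.
Context {T : Type} (O : T -> set nat) (D : T -> model_data).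
Hypothesis DO : udec O (fun t => model_code (D t)).

Lemma udec_member :
  udec O (fun t x => member (D t) (unpairl x) (unpairr x)).
Proof.
have := udec_evens DO; apply: udec_ext => t x.
rewrite /model_code /tuple_code evens_join; split.
  by move=> [i [n [-> ?]]]; rewrite !pairnK.
move=> h; exists (unpairl x), (unpairr x).
by rewrite /pairn -surjective_pairing Cantor.cancel_to_of.
Qed.

Lemma ucomp_jump_of : ucomp O (fun t => jump_of (D t)).
Proof.
have dec := udec_evens (udec_odds DO).
have [|h hh hP] := ucomp_search dec.
  move=> t n; exists (jump_of (D t) n).
  by rewrite /model_code /tuple_code odds_join evens_join; exists n.
apply: ucomp_ext hh => t n; have := hP t n.
by rewrite /model_code /tuple_code odds_join evens_join => -[i /pairn_inj[<-]].
Qed.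

Lemma ucomp_join_of a b : ucomp O a -> ucomp O b ->
  ucomp O (fun t n => join_of (D t) (a t n) (b t n)).
Proof.
move=> ha hb; have dec := udec_evens (udec_odds (udec_odds DO)).
have dec' := udec_comp2 dec (ucomp_pair (ucomp_comp ha (ucompl (ucomp_id O)))
  (ucomp_comp hb (ucompl (ucomp_id O)))) (ucompr (ucomp_id O)).
have [|h hh hP] := ucomp_search dec'.
  move=> t n; exists (join_of (D t) (a t n) (b t n)); rewrite !pairnK.
  by rewrite /model_code /tuple_code !odds_join evens_join; exists (a t n), (b t n).
apply: ucomp_ext hh => t n; have := hP t n.
rewrite /model_code /tuple_code !odds_join evens_join !pairnK.
by move=> [i [j /pairn_inj[/pairn_inj[<- <-]]]].
Qed.

Lemma ucomp_base : ucomp O (fun t _ => base (D t)).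
Proof.
have dec := udec_comp (udec_odds (udec_odds (udec_odds DO))) (ucompr (ucomp_id O)).
have [|h hh hP] := ucomp_search dec.
  by move=> t n; exists (base (D t)); rewrite /model_code /tuple_code !odds_join pairnKr.
apply: ucomp_ext hh => t n; have := hP t n.
by rewrite /model_code /tuple_code !odds_join pairnKr.
Qed.

Hypothesis eD : forall t, effective (D t).

(** The jump of a member that decides [R] is itself a member, and its index is
    obtained by iterating [jump_of]; so one code of the model replaces all the
    jumps needed for its members. *)
Lemma udec_member_arith (R : set nat -> set nat) : arith id R ->
  udec O (fun t x => R (member (D t) (unpairl x)) (unpairr x)).
Proof.
move=> [d hR].
have idx : ucomp O (fun t x => iter d (jump_of (D t)) (unpairl x)).
  have hl := ucompl (ucomp_id O).
  elim: d {hR} => [|d IH] //=; exact: ucomp_comp ucomp_jump_of IH.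
apply: (udec_subst hR (tau := fun t i => member (D t) i)).
apply: udec_ext (udec_comp2 udec_member idx (ucompr (ucomp_id O))) => t x.
by rewrite !pairnK member_jumps.
Qed.

End Models.

(** * Solving a problem by its reflection *)

Lemma weihrauch_le_rfn (P : problem) :
  has_arithmetical_representation P -> weihrauch_le P (rfn P).
Proof.
move=> [theta [eta [_ _ _ etaE]]].
pose solves Z := holds [tuple evens Z; odds Z] eta [tuple].
have solves_arith : arith id (fun Z _ => solves Z).
  apply: (arith_holds (O := id) (S := fun Z => [tuple evens Z; odds Z]) eta).
  move=> [i hi]; case: i hi => [|[|//]] hi.
    exact: udec_evens (udec_oracle id).
  exact: udec_odds (udec_oracle id).
(* Only models that contain a solution are parameters: the search must
   terminate. *)
pose T := {D | effective D &
  exists j, solves (join (member D (base D)) (member D j))}.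
pose O (t : T) := join (member (s2val t) (base (s2val t))) (model_code (s2val t)).
have DO : udec O (fun t => model_code (s2val t)).
  by apply: udec_ext (udec_odds (udec_oracle O)) => t n; rewrite /O odds_join.
have eD (t : T) : effective (s2val t) := s2valP t.
have dec := udec_comp2 (udec_member_arith DO eD solves_arith)
  (ucomp_join_of DO (ucomp_base DO) (ucompr (ucomp_id O))) (ucomp_const O 0).
have [|h hh hP] := ucomp_search dec.
  move=> t n; have [j hj] := s2valP' t.
  by exists j; rewrite !pairnK (model_join (eD t)).
(* The index found does not depend on the argument: the search is run at [0]
   whatever element of the solution is asked for. *)
have /udecP[c hc] := udec_comp2 (udec_member DO)
  (ucomp_comp hh (ucomp_const O 0)) (ucomp_id O).
exists (fun X Y => computes COracle X Y), (fun X Y => computes c X Y).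
split; [by exists COracle | by exists c |].
move=> X PX; exists X => //; split=> // _ [M [f [g [e [-> eM eX]]]]].
rewrite -{}eX in PX * => refl.
have [j Pj] := refl _ PX.
have ex : exists j, solves (join (M e) (M j)).
  by exists j; rewrite /solves evens_join odds_join; apply/etaE.
pose t : T := exist2 _ _ (ModelData M f g e) eM ex.
exists (M (h t 0)); last first.
  apply/etaE => //; have := hP t 0.
  by rewrite !pairnK (model_join (eD t)) /solves evens_join odds_join.
by have := hc t; under eq_fun do rewrite !pairnK.
Qed.

(** * The reflection is not reducible to the problem *)

(** A Löb-style argument.  If [delta x] fails, everything below [x] satisfies
    [delta]; but a [y] below [x] satisfying [delta] has a failing [z] below it,
    and [z] is below [x].  So [delta] holds everywhere, while [delta x] produces a
    failing element. *)
Lemma no_liar_descent U (lt : U -> U -> Prop) (good delta : U -> Prop) :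
  (forall x, good x -> exists2 y, good y & lt y x) ->
  (forall x y z, good x -> good y -> lt y x -> lt z y -> lt z x) ->
  (forall x, good x -> delta x <-> exists y, [/\ good y, lt y x & ~ delta y]) ->
  forall x, ~ good x.
Proof.
move=> inner trans deltaE.
have all_delta x : good x -> delta x.
  move=> gx; apply: contrapT => ndx.
  have below y : good y -> lt y x -> delta y.
    by move=> gy yx; apply: contrapT => ndy; apply/ndx/(deltaE x gx); exists y.
  have [y gy yx] := inner x gx.
  have [z [gz zy ndz]] := (deltaE y gy).1 (below y gy yx).
  exact/ndz/(below z gz)/(trans x y z).
move=> x gx; have [y [gy _]] := (deltaE x gx).1 (all_delta x gx).
by apply; apply: all_delta.
Qed.

Lemma arith_le_rfn_false (P : problem) :
  has_arithmetical_representation P -> ~ arith_weihrauch_le (rfn P) P.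
Proof.
move=> [theta [eta [_ total inE etaE]]] [Phi [Psi [[phi phiE] [psi psiE] red]]].
pose Z0 : set nat := [set n | holds [tuple set0] phi [tuple n]].
pose model_at A : set nat := [set n | holds [tuple join set0 (odds A)] psi [tuple n]].
pose good A := evens A = Z0 /\ outputs P Z0 (odds A).
have {red} [PZ0 red] : inputs P Z0 /\
    forall A, good A -> rfn_outputs P set0 (model_at A).
  have [Z /phiE -> [PZ hZ]] := red set0 I; split=> // A [_ /hZ[W /psiE ->]] //.
pose model_for A D := [/\ model_at A = model_code D, effective D,
  member D (base D) = set0 & forall i, inputs P (member D i) ->
    exists j, outputs P (member D i) (member D j)].
have has_model A : good A -> exists D, model_for A D.
  by move=> /red[M [f [g [e [? ? ? ?]]]]]; exists (ModelData M f g e).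
have set_dec k (S : set nat -> k.-tuple (set nat)) (chi : formula k 1) :
    (forall i, udec id (fun A => tnth (S A) i)) ->
    arith id (fun A => [set n | holds (S A) chi [tuple n]]).
  move=> /(arith_holds chi)[d hd]; exists d.
  have idc := ucomp_id (jumps d id).
  apply: udec_ext (udec_comp2 hd idc (ucomp_const _ 0)) => A n.
  by rewrite /= !pairnK; split.
have ev_dec := udec_evens (udec_oracle (@id (set nat))).
have od_dec := udec_odds (udec_oracle (@id (set nat))).
have Z0_dec : arith id (fun _ => Z0).
  apply: set_dec => -[i hi]; case: i hi => [|//] hi.
  by apply: ucomp_ext (ucomp_const id 0) => A n; case: asboolP.
have model_at_dec : arith id model_at.
  apply: set_dec => -[i hi]; case: i hi => [|//] hi.
  apply: (udec_join _ od_dec).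
  by apply: ucomp_ext (ucomp_const id 0) => A n; case: asboolP.
have good_dec : arith id (fun A _ => good A).
  have eq_dec : arith id (fun A _ => forall m, evens A m <-> Z0 m).
    have iff_dec := arith_and (arith_imp (arith_udec ev_dec) Z0_dec)
                              (arith_imp Z0_dec (arith_udec ev_dec)).
    have [d hd] := iff_dec; have idc := ucomp_id (jumps d (@id (set nat))).
    have [d' hd'] := arith_all (ex_intro _ d (udec_comp hd (ucompl idc))).
    exists d'; apply: udec_ext hd' => A n.
    by split=> h m; have := h m; rewrite !pairnK.
  have eta_dec : arith id (fun A _ => holds [tuple evens A; odds A] eta [tuple]).
    apply: (arith_holds (S := fun A => [tuple evens A; odds A]) eta).
    by move=> [i hi]; case: i hi => [|[|//]] hi.
  have [d hd] := arith_and eq_dec eta_dec; exists d.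
  apply: udec_ext hd => A _; rewrite /good; split=> [[h]|[e]].
    have e : evens A = Z0 by apply/seteqP; split=> n /h.
    by rewrite e => h'; split=> //; apply/etaE.
  by rewrite e => /etaE h'; split=> //; apply: h'.
have [d model_d] := model_at_dec.
pose T := {AD : set nat * model_data | model_for AD.1 AD.2}.
pose O (t : T) : set nat := jumps d id (sval t).1.
have DO : udec O (fun t => model_code (sval t).2).
  have := udec_trans (O := O) (tau := fun t : T => (sval t).1) model_d (udec_oracle O).
  by apply: udec_ext => t n; case: (svalP t) => ->.
have eD (t : T) : effective (sval t).2 by case: (svalP t).
have liar_dec : arith id (fun A n => good A /\ ~ jump (jumps d id A) n).
  apply: (arith_and good_dec); apply: arith_not.
  by exists d.+1; exact: (udec_oracle (jumps d.+1 id)).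
(* The negated condition costs no jump: the halting sets of the [d]-th jumps of
   the members are members themselves, so [p] needs only a code of the model. *)
have [p hp] : exists p, forall t n, (exists r, eval (O t) p n r) <->
    exists i, good (member (sval t).2 i) /\
      ~ jump (jumps d id (member (sval t).2 i)) n.
  have idc := ucomp_id O.
  have := udec_comp2 (udec_member_arith DO eD liar_dec) (ucompr idc) (ucompl idc).
  move=> /halting_ex[p hp]; exists p => t n; rewrite hp.
  by split=> -[i hi]; exists i; move: hi; rewrite !pairnK.
pose delta A := jump (jumps d id A) (encode p).
have deltaE A D : model_for A D ->
    delta A <-> exists i, good (member D i) /\ ~ delta (member D i).
  by move=> AD; rewrite /delta jump_encode (hp (exist _ (A, D) AD)).
(* Good sets exist in every model: [Z0] is arithmetical, hence a member, the
   model contains a solution of it, and it is closed under joins. *)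
have inner A D : model_for A D -> exists i, good (member D i).
  move=> [_ ED D0 refl].
  have [z hz] := member_arith_reduct ED Z0_dec (base D).
  have [|y hy] := refl z; first by rewrite hz.
  exists (join_of D z y); rewrite (model_join ED) /good evens_join odds_join.
  by rewrite -hz.
(* The model of a member is arithmetical in this member, hence a member too,
   and all its components are computable from it. *)
have trans A D i D' j : model_for A D -> model_for (member D i) D' ->
    exists l, member D l = member D' j.
  move=> [_ ED _ _] [e _ _ _].
  have [l hl] := member_arith_reduct ED model_at_dec i.
  apply: (model_turing_closed ED (i := l)); rewrite hl e.
  have := udec_member (udec_oracle model_code).
  move=> /udec_comp2/(_ (ucomp_const _ j) (ucomp_id _))/udecP[c hc]; exists c.
  by have := hc D'; under eq_fun do rewrite !pairnK.
have [Y hY] := total Z0 ((inE Z0).1 PZ0).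
pose lt B A := exists D i, model_for A D /\ member D i = B.
apply: (@no_liar_descent _ lt good delta _ _ _ (join Z0 Y)).
- move=> A /has_model[D AD]; have [i gi] := inner A D AD.
  by exists (member D i) => //; exists D, i.
- move=> A _ C _ _ [D [i [AD <-]]] [D' [j [AD' <-]]].
  by have [l hl] := trans A D i D' j AD AD'; exists D, l.
- move=> A /has_model[D0 AD0]; split.
    move=> /(deltaE A D0 AD0)[i [gi ndi]].
    by exists (member D0 i); split=> //; exists D0, i.
  move=> [B [gB [D [i [AD e]]] ndB]]; apply/(deltaE A D AD).
  by exists i; rewrite e.
- by rewrite /good evens_join odds_join; split=> //; apply/etaE.
Qed.

Theorem corollary4p13 (P : problem) (hP : has_arithmetical_representation P) :
  weihrauch_le P (rfn P) /\ ~ arith_weihrauch_le (rfn P) P.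
Proof. by split; [apply: weihrauch_le_rfn | apply: arith_le_rfn_false]. Qed.
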